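(* The machine $M$ defined in the context has no nontrivial periodic points in the moving head model: if $z=(q[\vec v],x)\in X_Q\times\Sigma^{\mathbb Z^2}$ contains the head, then $M^t(z)\neq z$ for all $t\ge 1$.
   Context: For a finite set $Q$ and a symbol $\#\notin Q$, $X_Q\subset (Q\cup\{\#\})^{\mathbb Z^2}$ is the set of configurations in which at most one coordinate carries an element of $Q$; for $q\in Q$ and $\vec v\in\mathbb Z^2$, $q[\vec v]\in X_Q$ is the unique configuration with value $q$ at $\vec v$. Headless configurations (those whose first component is $\#^{\mathbb Z^2}$) are fixed points and are the trivial periodic points. **The machine $M$** (in the moving head model, a map on $X_Q\times\Sigma^{\mathbb Z^2}$). $\Sigma=\{0,1\}$, $Q=\{\uparrow,\uparrow^*,\rightarrow,\leftarrow,\downarrow\}$. The states $\uparrow,\rightarrow,\leftarrow,\downarrow$ are identified with the unit vectors $(0,1),(1,0),(-1,0),(0,-1)$; for a unit vector $u$ let $R(u)$ be its clockwise rotation by 90 degrees (so $R(0,1)=(1,0)$). Headless configurations $(\#^{\mathbb Z^2},x)$ are fixed. One step from $(q[\vec v],x)$ consists of three phases. Phase 1: if $q=u\neq\,\uparrow^*$, $x_{\vec v}=0$, $x_{\vec v+u+R(u)}=1$ and $x_{\vec v+u}=x_{\vec v+R(u)}$, then (left turn) the state becomes $-R(u)$, $x_{\vec v}$ becomes $1$ and $x_{\vec v+u+R(u)}$ becomes $0$; if $q=u\ne\,\uparrow^*$, $x_{\vec v}=1$, $x_{\vec v+R(u)-u}=0$ and $x_{\vec v+R(u)}=x_{\vec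 v-u}$, then (right turn) the state becomes $R(u)$, $x_{\vec v}$ becomes $0$ and $x_{\vec v+R(u)-u}$ becomes $1$; otherwise nothing changes. Phase 2: if the current state is a unit vector $u$, the head moves from $\vec v$ to $\vec v+u$; if it is $\uparrow^*$, the head does not move. Phase 3: state $\uparrow$ is changed to $\uparrow^*$ and $\uparrow^*$ to $\uparrow$; other states are unchanged. *)

(* Defs.v *)
From mathcomp Require Import all_boot all_order all_algebra.
From mathcomp Require Import boolp.

Set Implicit Arguments.
Unset Strict Implicit.
Unset Printing Implicit Defensive.

Import GRing.Theory.
Local Open Scope ring_scope.

Variant dir : Type := North | East | West | South.

Definition vec (d : dir) : int * int :=
  match d with
  | North => (0, 1)
  | East => (1, 0)
  | West => (-1, 0)
  | South => (0, -1)
  end.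

(* Clockwise rotation by 90 degrees. *)
Definition rotcw (u : int * int) : int * int := (u.2, - u.1).

Definition turn_right (d : dir) : dir :=
  match d with
  | North => East | East => South | South => West | West => North
  end.

Definition turn_left (d : dir) : dir :=
  match d with
  | North => West | West => South | South => East | East => North
  end.

(* The states identified with unit vectors are [Dir d]; [UpStar] is the fifth
   state, and [Dir North] is the unstarred up-arrow. *)
Variant state : Type := Dir of dir | UpStar.

(* The binary alphabet: 0 is [false] and 1 is [true]. *)
Definition tape : Type := int * int -> bool.

Section MovingHeadModel.
Variable Q : Type.

(* The extra symbol # is [None]. *)
Definition at_most_one_head (c : int * int -> option Q) : Prop :=
  forall v w, c v <> None -> c w <> None -> v = w.

Definition XQ : Type := {c : int * int -> option Q | at_most_one_head c}.

Definition head_at_fun (q : Q) (v : int * int) : int * int -> option Q :=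
  fun w => if w == v then Some q else None.

Lemma head_at_proof (q : Q) (v : int * int) :
  at_most_one_head (head_at_fun q v).
Proof.
by move=> a b; rewrite /head_at_fun; case: eqP => // ->; case: eqP => // ->.
Qed.

(* The configuration q[v]. *)
Definition head_at (q : Q) (v : int * int) : XQ :=
  exist _ (head_at_fun q v) (@head_at_proof q v).

Definition has_head (c : XQ) : Prop :=
  exists p : Q * (int * int), sval c p.2 = Some p.1.

(* The head is unique in a configuration of [XQ], so the result does not depend
   on the choice made by [cid]. *)
Definition find_head (c : XQ) : option (Q * (int * int)) :=
  match pselect (has_head c) with
  | left h => Some (sval (cid h))
  | right _ => None
  end.

Lemma find_head_at (q : Q) (v : int * int) :
  find_head (head_at q v) = Some (q, v).
Proof.
rewrite /find_head; case: pselect => [h|[]]; last first.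
  by exists (q, v); rewrite /= /head_at_fun eqxx.
case: (cid h) => -[p w] /=; rewrite /head_at_fun.
by case: eqP => // -> [->].
Qed.

Lemma find_head_none (c : XQ) :
  (forall v, sval c v = None) -> find_head c = None.
Proof.
move=> cN; rewrite /find_head; case: pselect => // h.
by exfalso; case: h => p; rewrite cN.
Qed.

Lemma XQ_cases (c : XQ) :
  (forall v, sval c v = None) \/ (exists q v, c = head_at q v).
Proof.
case: (pselect (has_head c)) => [[[q v] /= cv]|nh]; [right|left].
  exists q, v; case: c cv => c c1 /= cv; apply: eq_exist.
  apply: funext => w; rewrite /head_at_fun; case: eqP => [->//|wv].
  by case cw: (c w) => [a|//]; case: wv; apply: c1; rewrite ?cw ?cv.
by move=> v; case cv: (sval c v) => [q|//]; case: nh; exists (q, v).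
Qed.

End MovingHeadModel.

Lemma vec_turn_right (d : dir) : vec (turn_right d) = rotcw (vec d).
Proof. by case: d. Qed.

Lemma vec_turn_left (d : dir) : vec (turn_left d) = - rotcw (vec d).
Proof. by case: d. Qed.

Definition phase1 (q : state) (v : int * int) (x : tape) : state * tape :=
  match q with
  | UpStar => (q, x)
  | Dir d =>
      let u := vec d in
      if [&& x v == false, x (v + u + rotcw u) == true
           & x (v + u) == x (v + rotcw u)] then
        (Dir (turn_left d),
         [eta x with v |-> true, v + u + rotcw u |-> false] : tape)
      else if [&& x v == true, x (v + rotcw u - u) == false
                & x (v + rotcw u) == x (v - u)] then
        (Dir (turn_right d),
         [eta x with v |-> false, v + rotcw u - u |-> true] : tape)
      else (q, x)
  end.

Definition phase2 (q : state) (v : int * int) : int * int :=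
  match q with
  | Dir d => v + vec d
  | UpStar => v
  end.

Definition phase3 (q : state) : state :=
  match q with
  | Dir North => UpStar
  | UpStar => Dir North
  | _ => q
  end.

Definition step (q : state) (v : int * int) (x : tape) : XQ state * tape :=
  let: (q', x') := phase1 q v x in (head_at (phase3 q') (phase2 q' v), x').

Definition M (z : XQ state * tape) : XQ state * tape :=
  match find_head z.1 with
  | Some (q, v) => step q v z.2
  | None => z
  end.

Lemma M_head (q : state) (v : int * int) (x : tape) :
  M (head_at q v, x) = step q v x.
Proof. by rewrite /M /= find_head_at. Qed.

Lemma M_headless (c : XQ state) (x : tape) :
  (forall v, sval c v = None) -> M (c, x) = (c, x).
Proof. by move=> cN; rewrite /M /= find_head_none. Qed.

(* Main.v *)
Require Import Defs.
From mathcomp Require Import all_boot all_order all_algebra.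
From mathcomp Require Import zify.

Set Implicit Arguments.
Unset Strict Implicit.
Unset Printing Implicit Defensive.

Import Order.TTheory GRing.Theory Num.Theory.
Local Open Scope ring_scope.

(* Suppose the head is on a periodic orbit, and let [Y] be the topmost row it
   visits. Row [Y + 1] can only lose 1s, so by periodicity it is constant, which
   excludes left turns in row [Y]. Row [Y] could gain a 1 only from a right turn
   in row [Y - 1], from west to north or from south to west; both are excluded
   because such a move follows or precedes a right turn in row [Y] whose
   condition on the tape is incompatible with it. So row [Y] is constant as well,
   which excludes right turns in row [Y]: the head runs straight in it forever. *)

Lemma head_at_inj (q q' : state) (v v' : int * int) :
  head_at q v = head_at q' v' -> q = q' /\ v = v'.
Proof.
by move=> /(congr1 (@find_head _)); rewrite !find_head_at => -[-> ->].
Qed.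

(** The same dynamics on plain triples, free of the encoding of heads in [XQ]. *)
Definition head_step (s : state * (int * int) * tape) :=
  let: (q, v, x) := s in
  let: (q', x') := phase1 q v x in (phase3 q', phase2 q' v, x').

Lemma iter_M_head t s :
  iter t M (head_at s.1.1 s.1.2, s.2) =
  let: (q, v, x) := iter t head_step s in (head_at q v, x).
Proof.
elim: t => [|t IHt] /=; first by case: s => [[]].
rewrite IHt; case: (iter t head_step s) => [[q v] x].
by rewrite M_head /step /=; case: (phase1 q v x).
Qed.

(** [f n] equals [f (n + T)], from which the value descends back to [f n.+1]. *)
Lemma periodic_nonincreasing (f : nat -> bool) (T : nat) :
  (0 < T)%N -> (forall n, f (n + T)%N = f n) ->
  (forall n, f n.+1 -> f n) -> forall n, f n.+1 = f n.
Proof.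
move=> T0 per dec n.
have decD m k : f (m + k)%N -> f m.
  by elim: k => [|k IHk]; rewrite ?addn0 // addnS => /dec.
apply/idP/idP => [/dec //|]; rewrite -per -(prednK T0) addnS -addSn.
exact: decD.
Qed.

Lemma periodic_argmax (f : nat -> int) (T : nat) :
  (0 < T)%N -> (forall n, f (n + T)%N = f n) ->
  exists m, forall n, f n <= f m.
Proof.
move=> T0 per; pose i0 : 'I_T := Ordinal T0.
case: (@arg_maxP _ _ _ i0 xpredT (fun i : 'I_T => f i)) => // i _ imax.
exists i => n.
have perM k m : f (m + k * T)%N = f m.
  by elim: k => [|k IHk]; rewrite ?addn0 // mulSn addnCA addnC per.
rewrite (divn_eq n T) addnC perM.
exact: (imax (Ordinal (ltn_pmod n T0))).
Qed.

Lemma int_pairE (a b : int * int) : a.1 = b.1 -> a.2 = b.2 -> a = b.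
Proof. by case: a b => [? ?] [? ?] /= -> ->. Qed.

Section PeriodicOrbit.
Variables (q : nat -> state) (v : nat -> int * int) (x : nat -> tape).
(** [Y] is an upper bound on the rows visited; the section shows that it is never attained. *)
Variables (T : nat) (Y : int).
Hypothesis stepE :
  forall n, (q n.+1, v n.+1, x n.+1) = head_step (q n, v n, x n).
Hypothesis T_gt0 : (0 < T)%N.
Hypothesis q_per : forall n, q (n + T)%N = q n.
Hypothesis v_per : forall n, v (n + T)%N = v n.
Hypothesis x_per : forall n, x (n + T)%N = x n.
Hypothesis v_le : forall n, (v n).2 <= Y.

Lemma step_UpStar n : q n = UpStar ->
  [/\ q n.+1 = Dir North, v n.+1 = v n & x n.+1 = x n].
Proof. by move=> qn; move: (stepE n); rewrite /head_step qn /= => -[]. Qed.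

(** Phases 2 and 3, with [d] the direction that phase 1 leaves. *)
Definition heads n d : Prop :=
  q n.+1 = phase3 (Dir d) /\ v n.+1 = v n + vec d.

Definition left_turn n d : Prop :=
  let u := vec d in
  [/\ x n (v n) = false, x n (v n + u + rotcw u) = true, heads n (turn_left d)
    & x n.+1 = [eta x n with v n |-> true, v n + u + rotcw u |-> false]].

Definition right_turn n d : Prop :=
  let u := vec d in
  [/\ [/\ x n (v n) = true, x n (v n + rotcw u - u) = false
        & x n (v n + rotcw u) = x n (v n - u)],
      heads n (turn_right d)
    & x n.+1 = [eta x n with v n |-> false, v n + rotcw u - u |-> true]].

Lemma step_Dir n d : q n = Dir d ->
  [\/ left_turn n d, right_turn n d | heads n d /\ x n.+1 = x n].
Proof.
move=> qn; move: (stepE n); rewrite /head_step qn /phase1.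
case: and3P => [[/eqP x0 /eqP x1 /eqP xE] [q' v' x']|_]; first exact: Or31.
case: and3P => [[/eqP x0 /eqP x1 /eqP xE] [q' v' x']|_ [q' v' x']].
  exact: Or32.
exact: Or33.
Qed.

(** Even time 0 has a past: [n] looks like [n + T], which is a successor. *)
Lemma predecessor n :
  exists m, [/\ q m.+1 = q n, v m.+1 = v n & x m.+1 = x n].
Proof.
exists (n + T.-1)%N.
by rewrite -addnS prednK // q_per v_per x_per.
Qed.

Lemma step_to_South n : q n.+1 = Dir South ->
  exists d, q n = Dir d /\ v n.+1 = v n + vec South.
Proof.
case qn: (q n) => [d|] qS; last by have [] := step_UpStar qn; rewrite qS.
exists d; split=> //.
have [d' []] : exists d', heads n d'.
  by have [[_ _ + _]|[_ + _]|[+ _]] := step_Dir qn => h; eexists; exact: h.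
by rewrite qS; case: d'.
Qed.

(** The head would have come down from row [Y + 1]. *)
Lemma top_not_South n : (v n).2 = Y -> q n <> Dir South.
Proof.
have [m [<- <- _]] := predecessor n; move=> vY /step_to_South [d [_ vE]].
by move: (v_le m) vY; rewrite vE /=; lia.
Qed.

Lemma right_turn_neq n d w : right_turn n d ->
  w <> v n -> w <> v n + rotcw (vec d) - vec d -> x n.+1 w = x n w.
Proof. by case=> _ _ -> /eqP/negPf w1 /eqP/negPf w2; rewrite /= w1 w2. Qed.

Lemma left_turn_dec n d w : left_turn n d -> w <> v n -> x n.+1 w -> x n w.
Proof. by case=> _ _ _ -> /eqP/negPf /= ->; case: eqP. Qed.

Lemma right_turn_dec n d w : right_turn n d ->
  w <> v n + rotcw (vec d) - vec d -> x n.+1 w -> x n w.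
Proof. by case=> _ _ -> /eqP/negPf /= ->; case: eqP. Qed.

(** Only a right turn from west or south writes a 1 above the head. From west the head would then
    move up to row [Y + 1]; in row [Y] it never faces south. *)
Lemma row_above_dec n (c : int * int) : c.2 = Y + 1 -> x n.+1 c -> x n c.
Proof.
move=> cY; case qn: (q n) => [d|]; last by have [_ _ ->] := step_UpStar qn.
have vY := v_le n; have [lt|rt|[_ ->] //] := step_Dir qn.
  by apply: left_turn_dec lt _ => cE; move: vY; rewrite -cE cY; lia.
apply: right_turn_dec (rt) _ => cE; have [_ [_ v'] _] := rt.
have := v_le n.+1; move: cY; rewrite cE v'.
case: d {rt v' cE} qn => /= qn; try lia.
by move=> vY' _; apply: (top_not_South _ qn); lia.
Qed.

Lemma row_above_const n (c : int * int) : c.2 = Y + 1 -> x n.+1 c = x n c.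
Proof.
move=> cY; apply: (periodic_nonincreasing T_gt0 (f := fun n => x n c)) => m.
  by rewrite x_per.
exact: row_above_dec.
Qed.

(* A left turn in row [Y] would remove a 1 from row [Y + 1], for good. *)
Lemma top_no_left_turn n d : q n = Dir d -> (v n).2 = Y -> ~ left_turn n d.
Proof.
move=> qn vY [_ xT [_ v'] x'].
have nS := top_not_South vY.
have cY : (v n + vec d + rotcw (vec d)).2 = Y + 1.
  (* From east, a left turn would lead up to row [Y + 1]. *)
  have := v_le n.+1; rewrite v'; case: d qn {xT v' x'} => //= qn; rewrite vY; lia.
have := row_above_const n cY; rewrite x' xT /= eqxx; case: eqP => // cE.
by move: cY; rewrite cE vY; lia.
Qed.

(* After this turn the head enters row [Y] facing north, where only a right turn
   is possible; but that turn needs the cell east of [v n] to be empty. *)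
Lemma no_right_turn_West n : (v n).2 + 1 = Y -> ~ right_turn n West.
Proof.
move=> vY rt; have [[xv _ xE] [q' v'] _] := rt.
have [q2 v2 x2] := step_UpStar q'.
have v2Y : (v n.+2).2 = Y by rewrite v2 v' /= -vY.
have [lt|[[x2v x2f _] _ _]|[[_ v3] _]] := step_Dir q2.
- exact: top_no_left_turn q2 v2Y lt.
- move: x2v x2f; rewrite x2 v2 v'.
  have -> : v n + vec (turn_right West) + rotcw (vec North) - vec North =
    v n - vec West by apply: int_pairE => /=; lia.
  (* The two cells read here are those that [rt] found equal, and [rt] rewrites neither. *)
  rewrite (right_turn_neq rt); last 2 first.
  + by move=> /(congr1 snd) /=; lia.
  + by move=> /(congr1 fst) /=; lia.
  rewrite (right_turn_neq rt); last 2 first.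
  + by move=> /(congr1 fst) /=; lia.
  + by move=> /(congr1 snd) /=; lia.
  by rewrite -xE => ->.
- by have := v_le n.+3; rewrite v3 /= v2Y; lia.
Qed.

(* The head has just left row [Y] by a right turn from east to south, which
   requires the two cells compared by the present turn to be equal. *)
Lemma no_right_turn_South n :
  q n = Dir South -> (v n).2 + 1 = Y -> ~ right_turn n South.
Proof.
have [m [<- vE xE]] := predecessor n.
move=> qm vY [[xv xf _] _ _]; have [d [qd v']] := step_to_South qm.
have vmY : (v m).2 = Y by rewrite -vY -vE v' /=; lia.
have [lt|rt|[[q' _] _]] := step_Dir qd.
- exact: top_no_left_turn qd vmY lt.
- have dE : d = East by have [_ [+ _] _] := rt; rewrite qm; case: d {rt qd}.
  rewrite {}dE in rt qd; have [[_ _ e] _ _] := rt.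
  move: xv xf; rewrite -vE -xE v'.
  have -> : v m + vec South + rotcw (vec South) - vec South = v m - vec East.
    by apply: int_pairE => /=; lia.
  rewrite (right_turn_neq rt); last 2 first.
  + by move=> /(congr1 snd) /=; lia.
  + by move=> /(congr1 fst) /=; lia.
  rewrite (right_turn_neq rt); last 2 first.
  + by move=> /(congr1 fst) /=; lia.
  + by move=> /(congr1 snd) /=; lia.
  by rewrite -e => ->.
(* Without a turn the head already faced south in row [Y]. *)
- by case: d qd q' => qd; rewrite qm // => _; case: (top_not_South vmY qd).
Qed.

Lemma top_row_dec n (c : int * int) : c.2 = Y -> x n.+1 c -> x n c.
Proof.
move=> cY; case qn: (q n) => [d|]; last by have [_ _ ->] := step_UpStar qn.
have vY := v_le n; have [lt|rt|[_ ->] //] := step_Dir qn.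
  by apply: left_turn_dec (lt) _ => cE; apply: top_no_left_turn qn _ lt; rewrite -cE.
apply: right_turn_dec (rt) _ => cE; move: cY; rewrite cE.
(* A right turn from north or east writes its 1 below the head, which would then be in row
   [Y + 1]. *)
case: d rt qn {cE} => rt qn /= cY; try lia.
  by apply: no_right_turn_West rt; lia.
by apply: no_right_turn_South rt => //; lia.
Qed.

Lemma top_row_const n (c : int * int) : c.2 = Y -> x n.+1 c = x n c.
Proof.
move=> cY; apply: (periodic_nonincreasing T_gt0 (f := fun n => x n c)) => m.
  by rewrite x_per.
exact: top_row_dec.
Qed.

(** A right turn would erase the 1 under the head, changing row [Y]. *)
Lemma top_straight n d : q n = Dir d -> (v n).2 = Y ->
  [/\ d = East \/ d = West, q n.+1 = Dir d & v n.+1 = v n + vec d].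
Proof.
move=> qn vY; have [lt|[[xv _ _] _ x']|[[q' v'] _]] := step_Dir qn.
- by case: (top_no_left_turn qn vY lt).
- by have := top_row_const n vY; rewrite x' /= eqxx xv.
have := top_not_South vY; have := v_le n.+1; rewrite q' v' qn /= vY.
case: d {qn q' v'} => /= vle nS; last by case: nS.
- by exfalso; lia.
- by split=> //; left.
- by split=> //; right.
Qed.

(** Running straight for one period shifts the head horizontally by [T] cells, yet it must return to
    its place. *)
Lemma top_no_Dir n d : q n = Dir d -> (v n).2 <> Y.
Proof.
move=> qn vY.
have straight k : [/\ q (n + k)%N = Dir d, (v (n + k)%N).2 = Y
    & (v (n + k)%N).1 = (v n).1 + (vec d).1 *+ k].
  elim: k => [|k [qk vk2 vk1]]; first by rewrite addn0 addr0.
  have [dEW q' v'] := top_straight qk vk2.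
  rewrite addnS q' v' mulrSr addrA -vk1; split=> //=.
  by rewrite vk2; case: dEW => -> /=; rewrite addr0.
have [dEW _ _] := top_straight qn vY; have [_ _] := straight T.
rewrite v_per -[LHS]addr0 => /addrI/esym/eqP.
by case: dEW => ->; rewrite mulrn_eq0 (gtn_eqF T_gt0).
Qed.

Lemma top_unvisited n : (v n).2 <> Y.
Proof.
case qn: (q n) => [d|]; first exact: top_no_Dir qn.
by have [q' <- _] := step_UpStar qn; apply: top_no_Dir q'.
Qed.

End PeriodicOrbit.

Theorem corollary1 (q : state) (v : int * int) (x : tape) (t : nat)
  (t_ge1 : (1 <= t)%N) :
  iter t M (head_at q v, x) <> (head_at q v, x).
Proof.
pose s n := iter n head_step (q, v, x).
have := iter_M_head t (q, v, x); rewrite /= -/(s t) => ->.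
case st: (s t) => [[q' v'] x'] zE.
have [qE vE] := head_at_inj (congr1 fst zE); have /= xE := congr1 snd zE.
have s_per n : s (n + t)%N = s n by rewrite /s iterD -/(s t) st qE vE xE.
have v_per n : (s (n + t)%N).1.2.2 = (s n).1.2.2 by rewrite s_per.
(* The row at time [m] serves as [Y], and it is visited at time [m]. *)
have [m mmax] := periodic_argmax t_ge1 v_per.
apply: (@top_unvisited (fun n => (s n).1.1) (fun n => (s n).1.2)
  (fun n => (s n).2) t (s m).1.2.2 _ t_ge1 _ _ _ mmax m) => // n;
  rewrite ?s_per //.
by rewrite -!surjective_pairing.
Qed.
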